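(* The continuous-time shift $\Theta_t$, $(\Theta_t w)(s)=w(s+t)$, acting on the Skorokhod space $\mathcal{D}$, is expanding for the Skorokhod metric $d$, in the following sense: given paths $w_1\in\mathcal{D}^*$ and $w_2,w_2'\in\mathcal{D}$, for all $t\ge 0$, $$d\big((w_1|^t\,w_2),(w_1|^t\,w_2')\big)\le\int_t^\infty e^{-u}\,du=e^{-t}.$$
   Context: $\mathcal{D}$ is the space of c\`adl\`ag (right continuous with left limits) paths $w:[0,\infty)\to[0,1]$. $\mathcal{D}^*$ is the set of paths $w_1:(-\infty,0]\to[0,1]$ that are right continuous on $(-\infty,0)$ and have left limits at every point of $(-\infty,0]$ (only the values on $(-\infty,0)$ matter). For $w_1\in\mathcal{D}^*$, $w_2\in\mathcal{D}$ and $t\ge0$, the path $(w_1|^t\,w_2)\in\mathcal{D}$ is defined for $s\ge0$ by $$(w_1|^t\,w_2)(s)=\begin{cases}w_1(s-t),& s<t,\\ w_2(s-t),& s\ge t;\end{cases}$$ thus $\Theta_t(w_1|^t\,w_2)=w_2$. Skorokhod metric (Ethier--Kurtz): let $\Lambda$ be the set of strictly increasing Lipschitz continuous functions $\lambda$ from $[0,\infty)$ onto $[0,\infty)$ with $\gamma(\lambda):=\operatorname{ess\,sup}_{t\ge0}|\log\lambda'(t)|<\infty$. Let $q(a,b)=|a-b|\wedge1$ for $a,b\in[0,1]$. For $x,y\in\mathcal{D}$, $\lambda\in\Lambda$, $u\ge0$, put $d(x,y,\lambda,u)=\sup_{s\ge0}q\big(x(s\wedge u),y(\lambda(s)\wedge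 u)\big)$, and $$d(x,y)=\inf_{\lambda\in\Lambda}\left[\gamma(\lambda)\vee\int_0^\infty e^{-u}d(x,y,\lambda,u)\,du\right].$$ *)

(* Defs.v *)
From HB Require Import structures.
From mathcomp Require Import all_boot all_order all_algebra.
From mathcomp Require Import all_classical all_reals all_analysis.
From mathcomp Require Import ess_sup_inf.

Set Implicit Arguments.
Unset Strict Implicit.
Unset Printing Implicit Defensive.
Import Order.TTheory GRing.Theory Num.Theory.
Import numFieldNormedType.Exports.

Local Open Scope classical_set_scope.
Local Open Scope ring_scope.

(* The space D of cadlag paths [0, +oo[ -> [0, 1]. A path is carried by a total
   function on R whose values on ]-oo, 0[ are irrelevant. *)
Record cadlag (R : realType) := Cadlag {
  cadlag_fun :> R -> R;
  cadlag01 : forall s : R, 0 <= s -> 0 <= cadlag_fun s <= 1;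
  cadlag_right : forall s : R, 0 <= s ->
    cadlag_fun x @[x --> s^'+] --> cadlag_fun s;
  cadlag_left : forall s : R, 0 < s -> cvg (cadlag_fun x @[x --> s^'-]) }.

(* The space D^* of past paths ]-oo, 0] -> [0, 1]. Right continuity is required
   only on ]-oo, 0[, while a left limit exists at 0 too; the values on ]0, +oo[
   of the underlying total function are irrelevant. *)
Record past (R : realType) := Past {
  past_fun :> R -> R;
  past01 : forall s : R, s <= 0 -> 0 <= past_fun s <= 1;
  past_right : forall s : R, s < 0 -> past_fun x @[x --> s^'+] --> past_fun s;
  past_left : forall s : R, s <= 0 -> cvg (past_fun x @[x --> s^'-]) }.

Lemma cvg_at_right_subr (R : realType) (s t : R) :
  x - t @[x --> s^'+] --> (s - t)^'+.
Proof.
move=> A [e /= e0 eA]; exists e => //= y /= ye sy.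
apply: eA => /=; last by rewrite ltrD2r.
by rewrite opprB addrA subrK.
Qed.

Lemma cvg_at_left_subr (R : realType) (s t : R) :
  x - t @[x --> s^'-] --> (s - t)^'-.
Proof.
move=> A [e /= e0 eA]; exists e => //= y /= ye sy.
apply: eA => /=; last by rewrite ltrD2r.
by rewrite opprB addrA subrK.
Qed.

Section concat.
Variables (R : realType) (w1 : past R) (t : R) (w2 : cadlag R).

Definition concat_fun (s : R) : R :=
  if s < t then w1 (s - t) else w2 (s - t).

Lemma concat01 s : 0 <= s -> 0 <= concat_fun s <= 1.
Proof.
move=> _; rewrite /concat_fun; case: ltP => st.
  by apply: past01; rewrite subr_le0 ltW.
by apply: cadlag01; rewrite subr_ge0.
Qed.

Lemma concat_right s : 0 <= s ->
  concat_fun x @[x --> s^'+] --> concat_fun s.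
Proof.
move=> _; rewrite {2}/concat_fun; case: ltP => st.
  apply: (@cvg_trans _ (w1 (x - t) @[x --> s^'+])).
    apply: near_eq_cvg; near=> x.
    by rewrite /concat_fun ifT//; near: x; exact: nbhs_right_lt.
  apply: (cvg_comp _ _ (@cvg_at_right_subr R s t)).
  by apply: past_right; rewrite subr_lt0.
apply: (@cvg_trans _ (w2 (x - t) @[x --> s^'+])).
  apply: near_eq_cvg; near=> x.
  suff sx : s <= x by rewrite /concat_fun ltNge (le_trans st sx).
  by near: x; exact: nbhs_right_ge.
apply: (cvg_comp _ _ (@cvg_at_right_subr R s t)).
by apply: cadlag_right; rewrite subr_ge0.
Unshelve. all: by end_near. Qed.

Lemma concat_left s : 0 < s -> cvg (concat_fun x @[x --> s^'-]).
Proof.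
move=> _; have [st|ts] := leP s t.
  have /cvg_ex[l wl] : cvg (w1 x @[x --> (s - t)^'-]).
    by apply: past_left; rewrite subr_le0.
  apply/cvg_ex; exists l.
  apply: (@cvg_trans _ (w1 (x - t) @[x --> s^'-])).
    apply: near_eq_cvg; near=> x.
    suff xs : x < s by rewrite /concat_fun (lt_le_trans xs st).
    by near: x; exact: nbhs_left_lt.
  exact: (cvg_comp _ _ (@cvg_at_left_subr R s t) wl).
have /cvg_ex[l wl] : cvg (w2 x @[x --> (s - t)^'-]).
  by apply: cadlag_left; rewrite subr_gt0.
apply/cvg_ex; exists l.
apply: (@cvg_trans _ (w2 (x - t) @[x --> s^'-])).
  apply: near_eq_cvg; near=> x.
  suff tx : t <= x by rewrite /concat_fun ltNge tx.
  by near: x; exact: nbhs_left_ge.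
exact: (cvg_comp _ _ (@cvg_at_left_subr R s t) wl).
Unshelve. all: by end_near. Qed.

Definition concat : cadlag R := Cadlag concat01 concat_right concat_left.

End concat.

Section shift.
Variables (R : realType) (t : R) (t0 : 0 <= t) (w : cadlag R).

Definition shift_fun (s : R) : R := w (s + t).

Lemma shift01 s : 0 <= s -> 0 <= shift_fun s <= 1.
Proof. by move=> s0; apply: cadlag01; exact: addr_ge0. Qed.

Lemma shift_right s : 0 <= s ->
  shift_fun x @[x --> s^'+] --> shift_fun s.
Proof.
move=> s0; have := @cvg_at_right_subr R s (- t); rewrite opprK => h.
by apply: (cvg_comp _ _ h); apply: cadlag_right; exact: addr_ge0.
Qed.

Lemma shift_left s : 0 < s -> cvg (shift_fun x @[x --> s^'-]).
Proof.
move=> s0; have := @cvg_at_left_subr R s (- t); rewrite opprK => h.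
have /cvg_ex[l wl] : cvg (w x @[x --> (s + t)^'-]).
  by apply: cadlag_left; exact: ltr_wpDr.
by apply/cvg_ex; exists l; exact: (cvg_comp _ _ h wl).
Qed.

Definition shift : cadlag R := Cadlag shift01 shift_right shift_left.

End shift.

Lemma shift_concat (R : realType) (t : R) (t0 : 0 <= t)
    (w1 : past R) (w2 : cadlag R) (s : R) :
  0 <= s -> shift t0 (concat w1 t w2) s = w2 s.
Proof.
by move=> s0; rewrite /= /shift_fun /= /concat_fun ltNge lerDr s0 /= addrK.
Qed.

Section skorokhod.
Context {R : realType}.
Local Open Scope ereal_scope.

Local Notation mu := (@lebesgue_measure R).

(* The ess sup over [0, +oo[ is taken for the restricted measure. A Lipschitz l
   has a derivative almost everywhere, so the junk value of derive1 elsewhere does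
   not matter; lne 0 = -oo, so that `|lne 0| = +oo. *)
Definition gamma (l : R -> R) : \bar R :=
  ess_sup (mrestr mu (measurable_itv `[0%R, +oo[))
    (fun t => `|lne (derive1 l t)%:E|).

(* Time changes, carried by total functions of which only the restriction to
   [0, +oo[ matters. *)
Definition Lambda : set (R -> R) :=
  [set l : R -> R | [/\ l @` [set` `[0%R, +oo[] = [set` `[0%R, +oo[],
               {in `[0%R, +oo[ &, {homo l : x y / (x < y)%R}},
               [lipschitz l x | x in [set` `[0%R, +oo[]] &
               gamma l < +oo]].

Definition q (a b : R) : R := Num.min `|a - b|%R 1%R.

Definition dist_at (x y : cadlag R) (l : R -> R) (u : R) : \bar R :=
  ereal_sup [set (q (x (Num.min s u)) (y (Num.min (l s) u)))%:E
            | s in [set` `[0%R, +oo[]].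

(* The J1 metric in the form of Ethier and Kurtz; \int of a nonnegative function
   is the supremum over the nonnegative simple functions below it, so it is
   meaningful without a proof that u |-> dist_at x y l u is measurable. *)
Definition skorokhod (x y : cadlag R) : \bar R :=
  ereal_inf [set maxe (gamma l)
    (\int[mu]_(u in `[0%R, +oo[) ((expR (- u))%:E * dist_at x y l u))
    | l in Lambda].

End skorokhod.

(* Main.v *)
(* Take the identity as time change. It costs nothing, and the two
   concatenated paths agree on [0, t[, so that the inner supremum vanishes for
   u < t; it is at most 1 for u >= t. *)
Require Import Defs.
From HB Require Import structures.
From mathcomp Require Import all_boot all_order all_algebra.
From mathcomp Require Import all_classical all_reals all_analysis.
From mathcomp Require Import ess_sup_inf.

Import Order.TTheory GRing.Theory Num.Theory.
Import numFieldNormedType.Exports.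

Local Open Scope classical_set_scope.
Local Open Scope ring_scope.
Local Open Scope ereal_scope.

(** Any single time change bounds the infimum. For the identity [gamma] is at most 0, so only the
    integral counts. Paths frozen at u < t show only the common past [w1] ([dist_at_concat_id]); for
    u >= t the truncation in [q] gives at most 1 ([dist_at_le1]). What remains is the tail of
    e^{-u}, computed in [integral_expRN]. *)

(* [ge0_le_integral] without measurability: the integral of a nonnegative
   function is a supremum over the simple functions below it. *)
Lemma le_integral_nonmeasurable {d} {T : measurableType d} {R : realType}
    (mu : {measure set T -> \bar R}) (D : set T) (f g : T -> \bar R) :
  (forall x, D x -> 0 <= f x) -> (forall x, D x -> f x <= g x) ->
  \int[mu]_(x in D) f x <= \int[mu]_(x in D) g x.
Proof.
move=> f0 fg; rewrite !ge0_integralE//; last first.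
  by move=> x Dx; exact: le_trans (f0 _ Dx) (fg _ Dx).
apply: ereal_sup_le => _ [h /= hf <-]; exists h => // x.
by apply: le_trans (hf x) _; exact: lee_restrict.
Qed.

(** The derivative is 1 everywhere and log 1 = 0. *)
Lemma gamma_id_le0 {R : realType} : gamma (@id R) <= 0.
Proof.
apply/ess_supP; apply: nearW => x.
by rewrite derive1_id lne1 abse0.
Qed.

Lemma id_Lambda {R : realType} : Lambda (@id R).
Proof.
split.
- by rewrite image_id.
- by [].
- apply: (@klipschitzW _ _ _ 1%R) => [|x _ /=]; last by rewrite mul1r.
  (* The filter is proper because its set of pairs contains (0, 0). *)
  apply: (@globally_properfilter _ _ (0, 0)%R).
  by split; rewrite /= in_itv/= lexx.
- exact: le_lt_trans gamma_id_le0 (ltry 0).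
Qed.

Lemma integral_expRN {R : realType} (t : R) :
  \int[@lebesgue_measure R]_(u in `[t, +oo[) (expR (- u))%:E = (expR (- t))%:E.
Proof.
have cexpN : continuous (fun u : R => expR (- u)).
  move=> u; apply: continuous_comp; first exact: opp_continuous.
  exact: continuous_expR.
rewrite (@ge0_continuous_FTC2y _ _ (fun u => - expR (- u))%R _ 0%R).
- by rewrite EFinN oppeK add0e.
- by move=> u _; exact: expR_ge0.
- exact: continuous_subspaceT.
- by rewrite -oppr0; apply: cvgN; exact: cvgr_expR.
- by move=> u _; exact: ex_derive.
- by apply: cvgN; apply/cvg_at_right_filter; exact: cexpN.
- by move=> u _; rewrite derive1E derive_val mulrN1 opprK.
Qed.

Lemma dist_at_ge0 {R : realType} (x y : cadlag R) (l : R -> R) (u : R) :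
  0 <= dist_at x y l u.
Proof.
(* An empty supremum would be -oo; time 0 supplies an element. *)
apply: le_ereal_sup_tmp; exists (q (x (Num.min 0 u)) (y (Num.min (l 0) u)))%:E.
  by exists 0%R => //=; rewrite in_itv/= lexx.
by rewrite lee_fin /q le_min normr_ge0 ler01.
Qed.

Lemma dist_at_le1 {R : realType} (x y : cadlag R) (l : R -> R) (u : R) :
  dist_at x y l u <= 1.
Proof.
by apply: ge_ereal_sup => _ [s _ <-]; rewrite lee_fin /q ge_min lexx orbT.
Qed.

(** Freezing at u < t keeps every time read below t, where both concatenations are w1(s - t). *)
Lemma dist_at_concat_id {R : realType} (w1 : past R) (w2 w2' : cadlag R)
    (t u : R) :
  (u < t)%R -> dist_at (concat w1 t w2) (concat w1 t w2') id u = 0.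
Proof.
move=> ut; apply/eqP; rewrite eq_le dist_at_ge0 andbT.
apply: ge_ereal_sup => _ [s _ <-] /=.
have st : (Num.min s u < t)%R by rewrite gt_min ut orbT.
by rewrite /concat_fun st /q subrr normr0 min_l.
Qed.

Theorem theorem3 (R : realType) (w1 : past R) (w2 w2' : cadlag R) (t : R)
    (t0 : (0 <= t)%R) :
  skorokhod (concat w1 t w2) (concat w1 t w2')
    <= \int[@lebesgue_measure R]_(u in `[t, +oo[) (expR (- u))%:E
  /\ \int[@lebesgue_measure R]_(u in `[t, +oo[) (expR (- u))%:E
     = (expR (- t))%:E.
Proof.
split; last exact: integral_expRN.
apply: ereal_inf_le; eexists; first by exists id; [exact: id_Lambda|reflexivity].
rewrite ge_max; apply/andP; split.
  apply: le_trans gamma_id_le0 _.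
  by apply: integral_ge0 => u _; rewrite lee_fin expR_ge0.
(* Extension by zero puts both integrals over the whole line, so that the different domains reduce
   to a pointwise comparison. *)
rewrite [leRHS]integral_mkcond [leLHS]integral_mkcond.
apply: le_integral_nonmeasurable => u _.
  apply: erestrict_ge0 => v _.
  by rewrite mule_ge0 ?lee_fin ?expR_ge0 ?dist_at_ge0.
rewrite !patchE !mem_setE !in_itv/= !andbT.
(* For u < t both sides are 0, whatever the sign of u. *)
have [tu|ut] := leP t u; last by rewrite dist_at_concat_id// mule0 if_same.
rewrite (le_trans t0 tu) -[leRHS]mule1; apply: lee_wpmul2l.
  by rewrite lee_fin expR_ge0.
exact: dist_at_le1.
Qed.
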